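(* With data, cone $K$ and constants $m_i$ as in the context, assume that for $i=1,2$ there exist $A_i>0$ and $\lambda_i>0$ such that for $f_i:[0,+\infty)\times\mathbb R\to[0,+\infty)$ one has - $H_i[u_1,u_2]\le A_i\|u_i\|$ for all $(u_1,u_2)\in K$, - $f_i(z_1,z_2)\le\lambda_im_i|z_i|$ for all $(z_1,z_2)\in[0,+\infty)\times\mathbb R$, - $\|\gamma_i\|A_i+\lambda_i<1$. Then the system $$u(t)=\gamma_1(t)H_1[u,v]+\int_0^1k_1(t,s)g_1(s)f_1(u(s),v(s))\,ds,\qquad v(t)=\gamma_2(t)H_2[u,v]+\int_0^1k_2(t,s)g_2(s)f_2(u(s),v(s))\,ds,\qquad t\in[0,1],$$ has no nontrivial solution in $K$, i.e. no solution $(u,v)\in K$ with $\|(u,v)\|>0$.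
   Context: **Data.** Let $n\ge 3$, $R_1>0$, $R_\eta,R_\xi\in(R_1,+\infty)$, $\beta_1,\delta_1\in\mathbb R$. For $t\in(0,1]$ put $r(t)=R_1t^{\frac1{2-n}}$ and $\phi(t)=r(t)\frac{R_1}{(n-2)^2}t^{\frac{2n-3}{2-n}}$. Let $\eta,\xi\in(0,1)$ be such that $r(\eta)=R_\eta$, $r(\xi)=R_\xi$, and put $\beta_2=(2-n)\delta_1\frac{\xi}{R_\xi}$. Assume $1\le\beta_1<\frac1\eta$ and $0\le\beta_2<1-\xi$. For $i=1,2$: $f_i$ is continuous; $h_i:[R_1,+\infty)\to[0,+\infty)$ is continuous and, for some $\mu_i>0$, $h_i(\rho)\le\rho^{-(n+\mu_i)}$ for all sufficiently large $\rho$; $g_i(t)=\phi(t)h_i(r(t))$. **Kernels.** $$k_1(t,s)=\frac{t(1-s)}{1-\beta_1\eta}-\begin{cases}\frac{\beta_1t(\eta-s)}{1-\beta_1\eta},&s\le\eta\\0,&s>\eta\end{cases}-\begin{cases}t-s,&s\le t\\0,&s>t\end{cases}$$ $$k_2(t,s)=\frac{t(1-s)}{1-\beta_2}-\begin{cases}\frac{\beta_2t}{1-\beta_2},&s\le\xi\\0,&s>\xi\end{cases}-\begin{cases}t-s,&s\le t\\0,&s>t\end{cases}$$ $$\gamma_1(t)=1+\frac{(\beta_1-1)t}{1-\beta_1\eta},\quad \gamma_2(t)=1-\frac t{1-\beta_2},\quad \Phi_1(s)=\frac{\beta_1s(1-s)}{1-\beta_1\eta},\quad \Phi_2(s)=\max\{1,\beta_2/\xi\}\frac{s(1-s)}{1-\beta_2}.$$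 **Constants.** Fix intervals $[a_1,b_1]\subset(0,1]$, $[a_2,b_2]\subset(0,1-\beta_2)$ and assume $\int_{a_i}^{b_i}\Phi_i(s)g_i(s)\,ds>0$ for $i=1,2$. Put $$c_{k_1}=\min\{a_1\eta,4a_1(1-\beta_1\eta)\eta,\eta(1-\beta_1\eta)\},\quad c_{k_2}=\frac{\min\{4a_2(1-\beta_2-\xi),\,1-b_2-\beta_2\}}{\max\{1,\beta_2/\xi\}},$$ $$c_{\gamma_1}=\frac{\beta_1-1}{\beta_1(1-\eta)}a_1+\frac{1-\beta_1\eta}{\beta_1(1-\eta)},\qquad c_{\gamma_2}=\begin{cases}\frac{1-\beta_2}{\beta_2}-\frac{b_2}{\beta_2},&\beta_2\ge1/2\\1-\frac{b_2}{1-\beta_2},&\beta_2\le1/2\end{cases}$$ and $c_i=\min\{c_{k_i},c_{\gamma_i}\}$. Put $\frac1{m_i}=\sup_{t\in[0,1]}\int_0^1|k_i(t,s)|g_i(s)\,ds$. **Cone.** $\|w\|=\max_{[0,1]}|w|$ on $C[0,1]$, $\|(u,v)\|=\max\{\|u\|,\|v\|\}$, and $K_1=\{w\in C[0,1]:w\ge0,\ \min_{[a_1,b_1]}w\ge c_1\|w\|\}$, $K_2=\{w\in C[0,1]:\min_{[a_2,b_2]}w\ge c_2\|w\|\}$, $K=K_1\times K_2$. For $i=1,2$, $H_i:K\to[0,\infty)$ is a compact functional (continuous, mapping bounded sets to relatively compact sets). *)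

(* Defs.v *)
From HB Require Import structures.
From mathcomp Require Import all_boot all_order all_algebra.
From mathcomp Require Import all_classical all_reals all_analysis.

Set Implicit Arguments.
Unset Strict Implicit.
Unset Printing Implicit Defensive.

Import Order.TTheory GRing.Theory Num.Theory.
Import numFieldNormedType.Exports.

Local Open Scope classical_set_scope.
Local Open Scope ring_scope.

(* C[0,1] is the set of functions R -> R whose restriction to [0,1] is
   continuous, inside the space Cspace of all functions R -> R with the
   topology of uniform convergence on [0,1], i.e. the topology of norm01.
   Functions equal on [0,1] are at distance 0; any continuous map from (a
   subset of) this space to R identifies them. *)
Notation Cspace R := {uniform` (`[0, 1] : set R) -> R}.

Section Data.
Context {R : realType}.
Implicit Types (n : nat) (a b c s t beta eta xi : R).

Definition rfun n (R1 : R) t : R := R1 * t `^ (2 - n%:R)^-1.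

Definition phifun n (R1 : R) t : R :=
  rfun n R1 t * (R1 / (n%:R - 2) ^+ 2)
  * t `^ ((2 * n%:R - 3) / (2 - n%:R)).

(* Only meant for 0 < t <= 1; the value at t = 0 is junk, which is harmless
   since gfun is only used under Lebesgue integrals. *)
Definition gfun n (R1 : R) (h : R -> R) t : R := phifun n R1 t * h (rfun n R1 t).

Definition k1 beta eta t s : R :=
  t * (1 - s) / (1 - beta * eta)
  - (if s <= eta then beta * t * (eta - s) / (1 - beta * eta) else 0)
  - (if s <= t then t - s else 0).

Definition k2 beta xi t s : R :=
  t * (1 - s) / (1 - beta)
  - (if s <= xi then beta * t / (1 - beta) else 0)
  - (if s <= t then t - s else 0).

Definition gamma1 beta eta t : R := 1 + (beta - 1) * t / (1 - beta * eta).

Definition gamma2 beta t : R := 1 - t / (1 - beta).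

Definition Phi1 beta eta s : R := beta * s * (1 - s) / (1 - beta * eta).

Definition Phi2 beta xi s : R :=
  Num.max 1 (beta / xi) * (s * (1 - s) / (1 - beta)).

Definition ck1 beta eta a : R :=
  Num.min (a * eta)
    (Num.min (4 * a * (1 - beta * eta) * eta) (eta * (1 - beta * eta))).

Definition ck2 beta xi a b : R :=
  Num.min (4 * a * (1 - beta - xi)) (1 - b - beta) / Num.max 1 (beta / xi).

Definition cgamma1 beta eta a : R :=
  (beta - 1) / (beta * (1 - eta)) * a
  + (1 - beta * eta) / (beta * (1 - eta)).

Definition cgamma2 beta b : R :=
  if 1 / 2 <= beta then (1 - beta) / beta - b / beta
  else 1 - b / (1 - beta).

Definition c1 beta eta a : R := Num.min (ck1 beta eta a) (cgamma1 beta eta a).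

Definition c2 beta xi a b : R := Num.min (ck2 beta xi a b) (cgamma2 beta b).

Definition mconst (k : R -> R -> R) (w : R -> R) : R :=
  (sup [set \int[lebesgue_measure]_(s in `[0, 1]) (`|k t s| * w s)
       | t in `[0, 1]])^-1.

Implicit Types (w : Cspace R) (uv : Cspace R * Cspace R).

Definition C01 : set (Cspace R) := [set w | {within (`[0, 1] : set R), continuous (w : R -> R)}].

(* For w in C[0,1] (and a <= b in K1, K2) the sup and inf below are attained,
   i.e. they are max and min. *)
Definition norm01 (w : R -> R) : R := sup [set `|w t| | t in `[0, 1]].

Definition norm2 uv : R := Num.max (norm01 uv.1) (norm01 uv.2).

Definition K1 a b c : set (Cspace R) :=
  [set w | [/\ C01 w, forall t, t \in `[0, 1] -> 0 <= w t
             & c * norm01 w <= inf [set w t | t in `[a, b]]]].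

Definition K2 a b c : set (Cspace R) :=
  [set w | C01 w /\ c * norm01 w <= inf [set w t | t in `[a, b]]].

Definition compact_functional (K : set (Cspace R * Cspace R))
    (H : Cspace R * Cspace R -> R) : Prop :=
  {within K, continuous H} /\
  forall B : set (Cspace R * Cspace R), B `<=` K ->
    (exists M, forall uv, B uv -> norm2 uv <= M) -> precompact (H @` B).

Definition h_data n (R1 : R) (h : R -> R) : Prop :=
  [/\ {within `[R1, +oo[, continuous h},
      forall rho, R1 <= rho -> 0 <= h rho
    & exists2 mu, 0 < mu & \forall rho \near +oo, h rho <= rho `^ - (n%:R + mu)].

Definition f_data (f : R * R -> R) : Prop :=
  {within [set z | 0 <= z.1], continuous f} /\
  forall z, 0 <= z.1 -> 0 <= f z.

Definition hammerstein (gam : R -> R) (k : R -> R -> R) (w : R -> R)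
    (H : Cspace R * Cspace R -> R) (f : R * R -> R) uv t : R :=
  gam t * H uv +
  \int[lebesgue_measure]_(s in `[0, 1]) (k t s * w s * f (uv.1 s, uv.2 s)).

End Data.

(* Main.v *)
Require Import Defs.
From HB Require Import structures.
From mathcomp Require Import all_boot all_order all_algebra.
From mathcomp Require Import all_classical all_reals all_analysis.
From mathcomp Require Import measurable_realfun ring lra.

Set Implicit Arguments.
Unset Strict Implicit.
Unset Printing Implicit Defensive.

Import Order.TTheory GRing.Theory Num.Theory.
Import numFieldNormedType.Exports.

Local Open Scope classical_set_scope.
Local Open Scope ring_scope.

(** A solution (u, v) in K satisfies, at each t in [0, 1],
[[
  |u t| <= |gamma1 t| H1[u, v] + \int |k1 t s| g1 s f1 (u s, v s) ds
        <= norm01 gamma1 * A1 * norm01 u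
           + lambda1 * norm01 u * m1 * \int |k1 t s| g1 s ds,
]]
and the last product is at most [lambda1 * norm01 u], because [1 / m1] is the
supremum of these integrals. Taking the supremum over t gives
[norm01 u <= (norm01 gamma1 * A1 + lambda1) * norm01 u] with a factor below 1,
so [norm01 u = 0]. The same argument applied to the second equation gives
[norm01 v = 0], so the solution is trivial. One lemma, [norm01_hammerstein_le],
serves both equations.

The integrals must really be finite and their integrands measurable, since
[Rintegral] sends an infinite or undefined integral to 0 and monotonicity would
otherwise fail. The weight [gfun n R1 h] may blow up at 0; what saves the
integrals is that [k t s = O(s)] ([k1_le], [k2_le]) while [s * gfun n R1 h s]
stays bounded ([bounded_mul_gfun]). The latter holds because
[s * phifun n R1 s] is a constant multiple of [rfun n R1 s ^+ n]
([mul_phifun]), so the weight is controlled by [rho ^+ n * h rho], which is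
bounded by the decay of h. *)

(** * Functions continuous on a subset *)

(** Composing with a retraction onto A extends a function continuous within A to
    one continuous everywhere, to which the measurability of continuous
    functions applies. *)
Lemma continuous_comp_within (S T U : topologicalType) (A : set T)
    (f : T -> U) (g : S -> T) :
  {within A, continuous f} -> continuous g -> (forall x, A (g x)) ->
  continuous (f \o g).
Proof.
move=> /subspace_continuousP cf cg gA x B /(cf _ (gA x)) fB.
have {}fB : \forall y \near g x, A y -> B (f y) by exact: fB.
have gB : nbhs x (g @^-1` [set y | A y -> B (f y)]) by exact: cg.
by apply: (filterS _ gB) => y /(_ (gA y)).
Qed.

Definition clamp01 (R : realType) (t : R) : R := Num.max 0 (Num.min 1 t).

Lemma clamp01_itv (R : realType) (t : R) : clamp01 t \in `[0, 1].
Proof.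
by rewrite in_itv/= /clamp01 le_max lexx/= ge_max ler01 ge_min lexx.
Qed.

Lemma clamp01_id (R : realType) (t : R) : t \in `[0, 1] -> clamp01 t = t.
Proof. by rewrite in_itv/= => /andP[t0 t1]; rewrite /clamp01 min_r// max_r. Qed.

Lemma continuous_clamp01 (R : realType) : continuous (@clamp01 R).
Proof.
move=> t; apply: (@continuous_max R R (fun=> 0) (fun t => Num.min 1 t)).
  exact: cvg_cst.
apply: (@continuous_min R R (fun=> 1) id).
  exact: cvg_cst.
exact: cvg_id.
Qed.

(** * The norm of C[0,1] *)

Lemma norm01_ub (R : realType) (w : R -> R) (t : R) :
  {within `[0, 1], continuous w} -> t \in `[0, 1] -> `|w t| <= norm01 w.
Proof.
move=> cw t01; have : bounded_set (w @` `[0, 1]).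
  by apply/compact_bounded/continuous_compact => //; exact: segment_compact.
case=> M [_ /(_ (M + 1))]; rewrite ltrDl ltr01 => /(_ isT) wM.
apply: sup_upper_bound; last by exists t.
split; first by exists `|w t|, t.
by exists (M + 1) => _ [s s01 <-]; apply: wM; exists s.
Qed.

Lemma norm01_le (R : realType) (w : R -> R) (c : R) :
  (forall t, t \in `[0, 1] -> `|w t| <= c) -> norm01 w <= c.
Proof.
move=> wc; apply: ge_sup => [|_ [t t01 <-]]; last exact: wc.
by exists `|w 0|, 0 => //=; rewrite in_itv/= lexx ler01.
Qed.

Lemma norm01_ge0 (R : realType) (w : R -> R) :
  {within `[0, 1], continuous w} -> 0 <= norm01 w.
Proof.
move=> cw; apply: (le_trans (normr_ge0 (w 0))); apply: norm01_ub => //.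
by rewrite in_itv/= lexx ler01.
Qed.

(** * Measurability of the superposition operator *)

(** Composing u and v with the retraction onto [0, 1] gives functions continuous
    on the whole line with the same values on [0, 1], with the first one still
    in the half plane where f is continuous. *)
Lemma measurable_superposition (R : realType) (f : R * R -> R) (u v : R -> R) :
  {within [set z | 0 <= z.1], continuous f} ->
  {within `[0, 1], continuous u} -> {within `[0, 1], continuous v} ->
  (forall s, s \in `[0, 1] -> 0 <= u s) ->
  measurable_fun (`[0, 1] : set R) (fun s => f (u s, v s)).
Proof.
move=> cf cu cv u0.
have cu' := continuous_comp_within cu (@continuous_clamp01 R) (@clamp01_itv R).
have cv' := continuous_comp_within cv (@continuous_clamp01 R) (@clamp01_itv R).
apply: (@eq_measurable_fun _ _ _ _ _
  (f \o fun s => (u (clamp01 s), v (clamp01 s)))).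
  by move=> s /set_mem s01 /=; rewrite clamp01_id.
apply: measurable_funTS; apply: continuous_measurable_fun.
apply: (continuous_comp_within cf) => [s|s /=].
  exact: (cvg_pair (cu' s) (cv' s)).
by apply: u0; exact: clamp01_itv.
Qed.

(** * The integral term *)

(** The integral is dominated by [lambda * mconst k w * N] times the integral of
    [|k t s| * w s], which is at most [(mconst k w)^-1] as one of the values
    whose supremum defines [mconst]. When that supremum is 0, in particular when
    the values are unbounded, [mconst k w = 0] and F vanishes. *)
Lemma Rintegral_le_mconst (R : realType) (k : R -> R -> R) (w F : R -> R)
    (lambda N t : R) :
  (forall s, s \in `[0, 1] -> 0 <= w s) ->
  lebesgue_measure.-integrable (`[0, 1] : set R)
    (EFin \o (fun s => `|k t s| * w s)) ->
  measurable_fun (`[0, 1] : set R) (fun s => k t s * w s * F s) ->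
  (forall s, s \in `[0, 1] -> 0 <= F s <= lambda * mconst k w * N) ->
  0 <= lambda -> 0 <= N -> t \in `[0, 1] ->
  `|\int[lebesgue_measure]_(s in `[0, 1]) (k t s * w s * F s)| <= lambda * N.
Proof.
move=> w0 ikw mkwF FN l0 N0 t01.
pose c := lambda * mconst k w * N.
have kwF s : s \in `[0, 1] -> `|k t s * w s * F s| <= c * (`|k t s| * w s).
  move=> s01; rewrite !normrM (ger0_norm (w0 _ s01)).
  have /andP[F0 Fc] := FN _ s01.
  rewrite (ger0_norm F0) mulrC; apply: ler_wpM2r => //.
  by rewrite mulr_ge0// w0.
have icw : lebesgue_measure.-integrable (`[0, 1] : set R)
    (EFin \o (fun s => c * (`|k t s| * w s))).
  exact: (integrableZl _ c ikw).
have ikwF : lebesgue_measure.-integrable (`[0, 1] : set R)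
    (EFin \o (fun s => k t s * w s * F s)).
  apply: le_integrable icw => //; first exact/measurable_EFinP.
  move=> s s01; rewrite /= lee_fin (le_trans (kwF _ s01))//.
  exact: ler_norm.
apply: le_trans (le_normr_Rintegral _ ikwF) _ => //.
rewrite -[leRHS]mulr1.
apply: (@le_trans _ _ (\int[lebesgue_measure]_(s in `[0, 1])
    (c * (`|k t s| * w s)))).
  by apply: le_Rintegral => //; exact: (integrable_norm ikwF).
rewrite RintegralZl// /c [lambda * _ * N]mulrAC -[leLHS]mulrA.
apply: ler_wpM2l; first exact: mulr_ge0.
rewrite /mconst.
set E := [set _ | _ in _].
have [supE|/sup_out->] := pselect (has_sup E); last first.
  by rewrite invr0 mul0r.
have kE : \int[lebesgue_measure]_(s in `[0, 1]) (`|k t s| * w s) <= sup E.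
  by apply: sup_upper_bound => //; exists t.
have [E0|En0] := eqVneq (sup E) 0; first by rewrite E0 invr0 mul0r.
have E_gt0 : 0 < sup E.
  rewrite lt_def En0 (le_trans _ kE)//; apply: Rintegral_ge0 => s s01.
  by rewrite mulr_ge0// w0.
by rewrite mulrC ler_pdivrMr// mul1r.
Qed.

(** * The weight near 0 *)

(** Beyond some radius the decay hypothesis gives [h rho <= rho `^ (- n)];
    up to that radius h is bounded by compactness. *)
Lemma bounded_mul_expn (R : realType) (n : nat) (R1 : R) (h : R -> R) :
  0 < R1 -> h_data n R1 h ->
  exists2 C, 0 <= C & forall rho, R1 <= rho -> h rho * rho ^+ n <= C.
Proof.
move=> R1_gt0 [ch h0 [mu mu0 [M [_ hM]]]].
(* Past T one has rho > M, where the decay holds, and rho >= 1, where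
   rho `^ (- (n + mu)) <= rho `^ (- n). *)
pose T := Num.max R1 (Num.max 1 (M + 1)).
have cT : {within `[R1, T], continuous h}.
  apply: continuous_subspaceW ch => x /=; rewrite !in_itv/= andbT.
  by case/andP.
have R1T : R1 <= T by rewrite le_max lexx.
have [x _ hx] := EVT_max R1T cT.
have T_ge0 : 0 <= T by exact: le_trans (ltW R1_gt0) R1T.
exists (Num.max 1 (h x * T ^+ n)) => [|rho R1rho].
  by rewrite le_max ler01.
have rho_gt0 : 0 < rho by exact: lt_le_trans R1rho.
rewrite le_max; have [rhoT|Trho] := leP rho T.
  apply/orP; right; have rho0 := ltW rho_gt0.
  have hrho : h rho <= h x by apply: hx; rewrite in_itv/= R1rho.
  by apply: ler_pM; rewrite ?exprn_ge0 ?h0// lerXn2r.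
apply/orP; left.
have [rho1 Mrho] : 1 <= rho /\ M < rho.
  move: Trho; rewrite /T !gt_max => /and3P[_ /ltW ? Mrho]; split => //.
  by apply: lt_trans Mrho; rewrite ltrDl.
apply: (@le_trans _ _ (rho `^ (- n%:R) * rho ^+ n)).
  apply: ler_wpM2r; first by rewrite exprn_ge0// ltW.
  apply: (le_trans (hM _ Mrho)); apply: ler_powR => //.
  by rewrite lerN2 lerDl ltW.
by rewrite powRN (powR_mulrn _ (ltW rho_gt0)) mulVf// lt0r_neq0// exprn_gt0.
Qed.

Lemma rfun_gt0 (R : realType) (n : nat) (R1 s : R) :
  0 < R1 -> 0 < s -> 0 < rfun n R1 s.
Proof. by move=> R1_gt0 s0; rewrite /rfun mulr_gt0// powR_gt0. Qed.

Lemma rfun_ge (R : realType) (n : nat) (R1 s : R) :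
  (3 <= n)%N -> 0 < R1 -> 0 < s <= 1 -> R1 <= rfun n R1 s.
Proof.
move=> n3 R1_gt0 s01; rewrite /rfun ler_peMr ?(ltW R1_gt0)//.
rewrite -[leLHS](powRr0 s) ger_powR//.
by rewrite invr_le0 subr_le0 ler_nat ltnW.
Qed.

(** This makes the weight vanish at the endpoint 0, where [rfun] takes the value
    0 and h may be negative. *)
Lemma phifun0 (R : realType) (n : nat) (R1 : R) :
  (3 <= n)%N -> phifun n R1 0 = 0.
Proof.
move=> n3; rewrite /phifun /rfun powR0 ?mulr0 ?mul0r//.
by rewrite invr_eq0 subr_eq0 eqr_nat neq_ltn n3.
Qed.

(** The exponents add up:
    [1 + 1 / (2 - n) + (2 n - 3) / (2 - n) = n / (2 - n)]. This is why a decay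
    of h of order n is exactly what keeps [s * gfun n R1 h s] bounded. *)
Lemma mul_phifun (R : realType) (n : nat) (R1 s : R) :
  (3 <= n)%N -> 0 < R1 -> 0 < s ->
  s * phifun n R1 s = R1 ^+ 2 / ((n%:R - 2) ^+ 2 * R1 ^+ n) * rfun n R1 s ^+ n.
Proof.
move=> n3 R1_gt0 s_gt0.
have sn0 : s != 0 by rewrite gt_eqF.
have n2 : (2 - n%:R : R) != 0 by rewrite subr_eq0 eqr_nat neq_ltn n3.
have n2' : (n%:R - 2 : R) != 0 by rewrite -oppr_eq0 opprB.
have powE : s * s `^ (2 - n%:R)^-1 * s `^ ((2 * n%:R - 3) / (2 - n%:R)) =
    (s `^ (2 - n%:R)^-1) ^+ n.
  rewrite -powR_mulrn ?powR_ge0// -powRrM -[X in X * _ * _]powRr1 ?ltW//.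
  rewrite -!powRD ?sn0 ?implybT//; congr (_ `^ _).
  by field.
rewrite /phifun /rfun exprMn -powE; field.
by rewrite n2' lt0r_neq0 ?exprn_gt0.
Qed.

Lemma gfun_ge0 (R : realType) (n : nat) (R1 : R) (h : R -> R) (s : R) :
  (3 <= n)%N -> 0 < R1 -> h_data n R1 h ->
  s \in `[0, 1] -> 0 <= gfun n R1 h s.
Proof.
move=> n3 R1_gt0 [_ h0 _].
rewrite in_itv/= le_eqVlt => /andP[/orP[/eqP<-|s0] s1].
  by rewrite /gfun phifun0// mul0r.
rewrite /gfun mulr_ge0 ?h0 ?rfun_ge ?s0//.
rewrite /phifun !mulr_ge0 ?powR_ge0//.
- by rewrite ltW// rfun_gt0.
- by rewrite ltW.
- by rewrite invr_ge0 sqr_ge0.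
Qed.

Lemma measurable_gfun (R : realType) (n : nat) (R1 : R) (h : R -> R) :
  (3 <= n)%N -> 0 < R1 -> h_data n R1 h ->
  measurable_fun (`[0, 1] : set R) (gfun n R1 h).
Proof.
move=> n3 R1_gt0 [ch _ _].
have mr : measurable_fun setT (rfun n R1).
  by apply: measurable_funM => //; exact: measurable_powR.
(* h is only continuous on [R1, +oo[; [h'] extends it continuously by the
   constant [h R1], and [rfun] takes ]0, 1] into [R1, +oo[. *)
pose h' := h \o Num.max R1.
have ch' : continuous h'.
  apply: (continuous_comp_within ch) => [x|x].
    exact: (@continuous_max _ _ (fun=> R1) id x (cvg_cst _) cvg_id).
  by rewrite /= in_itv/= le_max lexx.
apply: (@eq_measurable_fun _ _ _ _ _
    (fun s => phifun n R1 s * h' (rfun n R1 s))).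
  move=> s /set_mem /=; rewrite in_itv/= le_eqVlt.
  case/andP=> [/orP[/eqP<- _|s0 s1]]; first by rewrite /gfun phifun0// !mul0r.
  by rewrite /gfun /h' /= max_r// rfun_ge// s0.
apply: measurable_funTS; apply: measurable_funM.
  apply: measurable_funM; last exact: measurable_powR.
  exact: measurable_funM.
exact: measurableT_comp (continuous_measurable_fun ch') mr.
Qed.

Lemma bounded_mul_gfun (R : realType) (n : nat) (R1 : R) (h : R -> R) :
  (3 <= n)%N -> 0 < R1 -> h_data n R1 h ->
  exists2 C, 0 <= C & forall s, s \in `[0, 1] -> s * gfun n R1 h s <= C.
Proof.
move=> n3 R1_gt0 hP; have [C C0 hC] := bounded_mul_expn R1_gt0 hP.
pose D := R1 ^+ 2 / ((n%:R - 2) ^+ 2 * R1 ^+ n).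
have D0 : 0 <= D.
  have R1n m : 0 <= R1 ^+ m by rewrite exprn_ge0// ltW.
  by apply: divr_ge0 => //; apply: mulr_ge0 => //; exact: sqr_ge0.
exists (D * C); first exact: mulr_ge0.
move=> s; rewrite in_itv/= le_eqVlt => /andP[/orP[/eqP<- _|s0 s1]].
  by rewrite mul0r mulr_ge0.
rewrite /gfun mulrA mul_phifun// -/D -mulrA; apply: ler_wpM2l => //.
by rewrite mulrC hC// rfun_ge// s0.
Qed.

(** The integrand is bounded: the kernel contributes a factor s, which cancels
    the singularity of the weight. *)
Lemma integrable_kernel_gfun (R : realType) (n : nat) (R1 : R) (h : R -> R)
    (k : R -> R) (C : R) :
  (3 <= n)%N -> 0 < R1 -> h_data n R1 h ->
  measurable_fun setT k ->
  (forall s, s \in `[0, 1] -> `|k s| <= C * s) ->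
  lebesgue_measure.-integrable (`[0, 1] : set R)
    (EFin \o (fun s => `|k s| * gfun n R1 h s)).
Proof.
move=> n3 R1_gt0 hP mk kC; have [D D0 gD] := bounded_mul_gfun n3 R1_gt0 hP.
have g0 s := gfun_ge0 n3 R1_gt0 hP (s := s).
have C0 : 0 <= C.
  have /kC : (1 : R) \in `[0, 1] by rewrite in_itv/= lexx ler01.
  by rewrite mulr1; exact: le_trans.
apply: measurable_bounded_integrable => //.
- by rewrite /= lebesgue_measure_itv/= lte01 -EFinB ltry.
- apply: measurable_funM; last exact: measurable_gfun.
  by apply: measurable_funTS; exact: measurableT_comp.
exists (C * D); split; first by rewrite num_real.
move=> M CDM s s01 /=; rewrite normrM normr_id (ger0_norm (g0 _ s01)).
apply: (le_trans _ (ltW CDM)).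
apply: (@le_trans _ _ (C * s * gfun n R1 h s)).
  by apply: ler_wpM2r; [exact: g0|exact: kC].
by rewrite -mulrA; apply: ler_wpM2l => //; exact: gD.
Qed.

(** * The kernels *)

Lemma measurable_k1 (R : realType) (beta eta t : R) :
  measurable_fun setT (k1 beta eta t).
Proof.
rewrite /k1; apply: measurable_funB; first apply: measurable_funB.
- apply: measurable_funM => //; apply: measurable_funM => //.
  exact: measurable_funB.
- apply: measurable_fun_ifT => //; first exact: measurable_fun_ler.
  apply: measurable_funM => //; apply: measurable_funM => //.
  exact: measurable_funB.
- apply: measurable_fun_ifT => //; first exact: measurable_fun_ler.
  exact: measurable_funB.
Qed.

Lemma measurable_k2 (R : realType) (beta xi t : R) :
  measurable_fun setT (k2 beta xi t).
Proof.
rewrite /k2; apply: measurable_funB; first apply: measurable_funB.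
- apply: measurable_funM => //; apply: measurable_funM => //.
  exact: measurable_funB.
- by apply: measurable_fun_ifT => //; exact: measurable_fun_ler.
- apply: measurable_fun_ifT => //; first exact: measurable_fun_ler.
  exact: measurable_funB.
Qed.

(** The kernel is in fact between 0 and [gamma1 beta eta 1 * s]. With
    [q = (1 - beta * eta)^-1] and [a = (beta - 1) * q] it equals
    [s * (1 + t * a)] for s <= t and [t * (1 + s * a)] for t < s as long as
    s <= eta; for s > eta these values are decreased by
    [beta * t * (s - eta) * q]. *)
Lemma k1_le (R : realType) (beta eta t s : R) :
  0 < eta -> 1 <= beta -> beta * eta < 1 ->
  t \in `[0, 1] -> s \in `[0, 1] ->
  `|k1 beta eta t s| <= gamma1 beta eta 1 * s.
Proof.
move=> eta0 b1 be1; rewrite !in_itv/= => /andP[t0 t1] /andP[s0 s1].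
rewrite /k1 /gamma1 mulr1; set q := (1 - beta * eta)^-1.
have qE : q * (1 - beta * eta) = 1 by rewrite mulVf// gt_eqF// subr_gt0.
have q0 : 0 <= q by rewrite invr_ge0 subr_ge0 ltW.
have be0 : 0 <= beta * eta by rewrite mulr_ge0 ?(ltW eta0)//; lra.
(* Because q = 1 + beta * eta * q. *)
have q1 : 1 <= q by nra.
pose a := (beta - 1) * q.
have a0 : 0 <= a by rewrite mulr_ge0// subr_ge0.
have ta : t * a <= a by rewrite ler_piMl.
rewrite -/a ler_norml.
have XE : beta * t * (eta - s) * q = t * (q * (1 - s) - 1 - s * a).
  apply/eqP; rewrite -subr_eq0; apply/eqP.
  transitivity (t * (1 - q * (1 - beta * eta))); first by rewrite /a; ring.
  by rewrite qE subrr mulr0.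
have sta : s * (t * a) <= s * a by rewrite ler_wpM2l.
have sta0 : 0 <= s * (t * a) by do 2 ?[apply: mulr_ge0 => //].
have tsa : t * (s * a) <= s * (t * a) by rewrite mulrCA.
have [se|es] := leP s eta.
  rewrite XE; have [st|ts] := leP s t; first lra.
  have tsa' : t * (s * a) <= s * (s * a).
    by apply: ler_wpM2r; [exact: mulr_ge0|exact: ltW].
  lra.
(* Past eta the kernel no longer subtracts this term, which would be nonpositive
   there. *)
have X0 : beta * t * (eta - s) * q <= 0.
  have -> : beta * t * (eta - s) * q = t * q * beta * (eta - s) by ring.
  apply: mulr_ge0_le0; last by rewrite subr_le0 ltW.
  by apply: mulr_ge0; [exact: mulr_ge0|lra].
have tsq : t * (1 - s) <= t * (1 - s) * q.
  by rewrite ler_peMr// mulr_ge0// subr_ge0.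
have tl : t * s <= s by rewrite ler_piMl.
have tsq0 : 0 <= t * (1 - s) by rewrite mulr_ge0// subr_ge0.
have [st|ts] := leP s t; lra.
Qed.

(** With [q = (1 - beta)^-1 >= 1], the kernel is [s * (1 - t * q)] or
    [t * (1 - s * q)] when s <= xi, both at most [q * s] in absolute value.
    For s > xi the additional term [beta * t * q] is at most
    [beta / xi * q * s], which accounts for the second summand of the
    constant. *)
Lemma k2_le (R : realType) (beta xi t s : R) :
  0 < xi -> 0 <= beta < 1 ->
  t \in `[0, 1] -> s \in `[0, 1] ->
  `|k2 beta xi t s| <= (1 + beta / xi) / (1 - beta) * s.
Proof.
move=> xi0 /andP[b0 b1]; rewrite !in_itv/= => /andP[t0 t1] /andP[s0 s1].
rewrite /k2; set q := (1 - beta)^-1.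
have qE : q * (1 - beta) = 1 by rewrite mulVf// gt_eqF// subr_gt0.
have q0 : 0 <= q by rewrite invr_ge0 subr_ge0 ltW.
have q1 : 1 <= q by have := mulr_ge0 q0 b0; lra.
have bq : beta * q = q - 1 by lra.
have tq : t * q <= q by rewrite ler_piMl.
have tq0 : 0 <= t * q by rewrite mulr_ge0.
have sq0 : 0 <= s * q by rewrite mulr_ge0.
have sq1 : s <= s * q by rewrite ler_peMr.
have stq : s * (t * q) <= s * q by rewrite ler_wpM2l.
have stq0 : 0 <= s * (t * q) by rewrite mulr_ge0.
have bx0 : 0 <= beta / xi * (s * q) by rewrite mulr_ge0// divr_ge0// ltW.
have -> : (1 + beta / xi) * q * s = s * q + beta / xi * (s * q) by ring.
have -> : t * (1 - s) * q = t * q - s * (t * q) by ring.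
have -> : beta * t * q = t * (beta * q) by ring.
rewrite ler_norml bq.
have [sx|xs] := leP s xi; have [st|ts] := leP s t.
- lra.
- have tsq : t * q <= s * q by apply: ler_wpM2r => //; exact: ltW.
  lra.
- have bsx : t * (beta * q) <= beta / xi * (s * q).
    have : t * (beta * q) <= beta * q by rewrite ler_piMl// mulr_ge0.
    move=> /le_trans; apply.
    rewrite mulrA ler_wpM2r// -mulrA ler_peMr// mulrC ler_pdivlMr// mul1r.
    exact: ltW.
  have : 0 <= t * (beta * q) by do 2 ?[apply: mulr_ge0 => //].
  rewrite bq in bsx *; lra.
- have tsq : t * q <= s * q by apply: ler_wpM2r => //; exact: ltW.
  lra.
Qed.

(** * The contraction estimate *)

(** Here p stands for either component of the pair, so that the same statement
    covers both equations of the system. *)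
Lemma norm01_hammerstein_le (R : realType) (gam : R -> R) (k : R -> R -> R)
    (w : R -> R) (H : Cspace R * Cspace R -> R) (f : R * R -> R)
    (uv : Cspace R * Cspace R) (p : R -> R) (A lambda : R) :
  {within `[0, 1], continuous gam} ->
  (forall t, measurable_fun setT (k t)) ->
  (forall s, s \in `[0, 1] -> 0 <= w s) ->
  measurable_fun (`[0, 1] : set R) w ->
  (forall t, t \in `[0, 1] -> lebesgue_measure.-integrable (`[0, 1] : set R)
    (EFin \o (fun s => `|k t s| * w s))) ->
  f_data f -> C01 uv.1 -> C01 uv.2 ->
  (forall s, s \in `[0, 1] -> 0 <= uv.1 s) ->
  {within `[0, 1], continuous p} ->
  (forall s, s \in `[0, 1] ->
    f (uv.1 s, uv.2 s) <= lambda * mconst k w * `|p s|) ->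
  0 <= lambda -> 0 <= lambda * mconst k w ->
  0 <= H uv <= A * norm01 p ->
  (forall t, t \in `[0, 1] -> p t = hammerstein gam k w H f uv t) ->
  norm01 p <= (norm01 gam * A + lambda) * norm01 p.
Proof.
move=> cgam mk w0 mw ikw [cf f0] cu cv u0 cp fp l0 lm0 /andP[H0 HA] pE.
have p0 := norm01_ge0 cp.
apply: norm01_le => t t01; rewrite pE// /hammerstein.
apply: (le_trans (ler_normD _ _)); rewrite mulrDl; apply: lerD.
  rewrite normrM (ger0_norm H0) -mulrA.
  by apply: ler_pM => //; exact: norm01_ub.
apply: Rintegral_le_mconst => //; first exact: ikw.
  apply: measurable_funM; last exact: measurable_superposition.
  by apply: measurable_funM => //; apply: measurable_funTS; exact: mk.
move=> s s01; rewrite f0 ?u0//=; apply: (le_trans (fp _ s01)).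
by apply: ler_wpM2l => //; exact: norm01_ub.
Qed.

Lemma continuous_gamma1 (R : realType) (beta eta : R) :
  continuous (gamma1 beta eta).
Proof.
move=> t; apply: cvgD; first exact: cvg_cst.
apply: cvgM; last exact: cvg_cst.
by apply: cvgM; [exact: cvg_cst|exact: cvg_id].
Qed.

Lemma continuous_gamma2 (R : realType) (beta : R) : continuous (@gamma2 R beta).
Proof.
move=> t; apply: cvgB; first exact: cvg_cst.
by apply: cvgM; [exact: cvg_id|exact: cvg_cst].
Qed.

Lemma contraction_eq0 (R : realType) (theta x : R) :
  theta < 1 -> 0 <= x -> x <= theta * x -> x = 0.
Proof. by move=> th1 x0 xth; apply/eqP; rewrite eq_le x0 andbT; nra. Qed.

(** * Nonexistence *)

Theorem theorem2p12 (R : realType) (n : nat)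
    (R1 Reta Rxi beta1 delta1 eta xi beta2 : R)
    (h1 h2 : R -> R) (f1 f2 : R * R -> R)
    (a1 b1 a2 b2 : R)
    (H1 H2 : Cspace R * Cspace R -> R)
    (A1 A2 lambda1 lambda2 : R)
    (n_ge3 : (3 <= n)%N) (R1_gt0 : 0 < R1)
    (Reta_gtR1 : R1 < Reta) (Rxi_gtR1 : R1 < Rxi)
    (eta01 : 0 < eta < 1) (xi01 : 0 < xi < 1)
    (etaE : rfun n R1 eta = Reta) (xiE : rfun n R1 xi = Rxi)
    (beta2E : beta2 = (2 - n%:R) * delta1 * (xi / Rxi))
    (beta1_bnd : 1 <= beta1 < 1 / eta) (beta2_bnd : 0 <= beta2 < 1 - xi)
    (h1P : h_data n R1 h1) (h2P : h_data n R1 h2)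
    (f1P : f_data f1) (f2P : f_data f2)
    (ab1 : [/\ 0 < a1, a1 <= b1 & b1 <= 1])
    (ab2 : [/\ 0 < a2, a2 <= b2 & b2 < 1 - beta2]) :
  let g1 := gfun n R1 h1 in
  let g2 := gfun n R1 h2 in
  let m1 := mconst (k1 beta1 eta) g1 in
  let m2 := mconst (k2 beta2 xi) g2 in
  let K := K1 a1 b1 (c1 beta1 eta a1) `*` K2 a2 b2 (c2 beta2 xi a2 b2) in
  0 < \int[lebesgue_measure]_(s in `[a1, b1]) (Phi1 beta1 eta s * g1 s) ->
  0 < \int[lebesgue_measure]_(s in `[a2, b2]) (Phi2 beta2 xi s * g2 s) ->
  compact_functional K H1 -> (forall uv, K uv -> 0 <= H1 uv) ->
  compact_functional K H2 -> (forall uv, K uv -> 0 <= H2 uv) ->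
  0 < A1 -> 0 < A2 -> 0 < lambda1 -> 0 < lambda2 ->
  (forall uv, K uv -> H1 uv <= A1 * norm01 uv.1) ->
  (forall uv, K uv -> H2 uv <= A2 * norm01 uv.2) ->
  (forall z1 z2, 0 <= z1 -> f1 (z1, z2) <= lambda1 * m1 * `|z1|) ->
  (forall z1 z2, 0 <= z1 -> f2 (z1, z2) <= lambda2 * m2 * `|z2|) ->
  norm01 (gamma1 beta1 eta) * A1 + lambda1 < 1 ->
  norm01 (gamma2 beta2) * A2 + lambda2 < 1 ->
  ~ exists uv : Cspace R * Cspace R,
      [/\ K uv, 0 < norm2 uv
        & forall t, t \in `[0, 1] ->
            uv.1 t = hammerstein (gamma1 beta1 eta) (k1 beta1 eta) g1 H1 f1 uv t /\
            uv.2 t = hammerstein (gamma2 beta2) (k2 beta2 xi) g2 H2 f2 uv t].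
Proof.
move=> g1 g2 m1 m2 K _ _ _ H1_ge0 _ H2_ge0 A1_gt0 A2_gt0 l1_gt0 l2_gt0 H1A H2A.
move=> f1l f2l theta1 theta2 [[u v] [Kuv uv_gt0 uvE]].
have [/= [cu u0 _] [cv _]] := Kuv.
case/andP: eta01 => eta0 eta1; case/andP: xi01 => xi0 xi1.
case/andP: beta1_bnd => beta1_ge1 beta1_lt.
case/andP: beta2_bnd => beta2_ge0 beta2_lt.
have be1 : beta1 * eta < 1 by rewrite -ltr_pdivlMr.
(* Nonnegative since it bounds [f1] from above at the point (1, 1). *)
have lm1 : 0 <= lambda1 * m1.
  have := f1l 1 1 ler01; rewrite normr1 mulr1; apply: le_trans.
  by case: f1P => _; apply.
have lm2 : 0 <= lambda2 * m2.
  have := f2l 1 1 ler01; rewrite normr1 mulr1; apply: le_trans.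
  by case: f2P => _; apply.
have nu : norm01 u = 0.
  apply: (contraction_eq0 theta1); first exact: norm01_ge0.
  apply: (@norm01_hammerstein_le _ _ (k1 beta1 eta) g1 H1 f1 (u, v)) => //.
  - exact/continuous_subspaceT/continuous_gamma1.
  - exact: measurable_k1.
  - by move=> s; exact: gfun_ge0.
  - exact: measurable_gfun.
  - move=> t t01; apply: (integrable_kernel_gfun n_ge3 R1_gt0 h1P) => [|s s01].
      exact: measurable_k1.
    exact: k1_le.
  - by move=> s s01; apply: f1l; exact: u0.
  - exact: ltW.
  - by rewrite H1_ge0//= H1A.
  - by move=> t /uvE[].
have nv : norm01 v = 0.
  apply: (contraction_eq0 theta2); first exact: norm01_ge0.
  apply: (@norm01_hammerstein_le _ _ (k2 beta2 xi) g2 H2 f2 (u, v)) => //.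
  - exact/continuous_subspaceT/continuous_gamma2.
  - exact: measurable_k2.
  - by move=> s; exact: gfun_ge0.
  - exact: measurable_gfun.
  - move=> t t01; apply: (integrable_kernel_gfun n_ge3 R1_gt0 h2P) => [|s s01].
      exact: measurable_k2.
    apply: k2_le => //; rewrite beta2_ge0/=; lra.
  - by move=> s s01; apply: f2l; exact: u0.
  - exact: ltW.
  - by rewrite H2_ge0//= H2A.
  - by move=> t /uvE[].
by move: uv_gt0; rewrite /norm2 /= nu nv maxxx ltxx.
Qed.
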